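(* Let $X,Y,B_0,D$ be as described in the context, and let $\mathcal{A}\in\operatorname{S}^d(\mathbb{C}^{n+1})$. Then: (i) If $G\in\mathcal{G}(\mathcal{A})$ and $v_1,\dots,v_r\in Y$ are distinct zeros of $\varphi[G]$, then there exist scalars $\lambda_1,\dots,\lambda_r\in\mathbb{C}$ such that $$\mathcal{A}=\lambda_1(1,v_1)^{\otimes d}+\cdots+\lambda_r(1,v_r)^{\otimes d}.$$ (ii) If $\mathcal{A}=\lambda_1(1,v_1)^{\otimes d}+\cdots+\lambda_r(1,v_r)^{\otimes d}$ holds for some $v_1,\dots,v_r\in Y$ and scalars $\lambda_1,\dots,\lambda_r\in\mathbb{C}$, and $(v_1,\dots,v_r)\in D$, then there exists a unique $G\in\mathcal{G}(\mathcal{A})$ such that $v_1,\dots,v_r$ are zeros of $\varphi[G]$.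
   Context: Let $X=\{x\in\mathbb{C}^{n+1}: h_1(x)=\cdots=h_M(x)=0\}$ with $h_i$ homogeneous polynomials in $x=(x_0,\dots,x_n)$, and let $Y=\{y\in\mathbb{C}^n: h_i(1,y_1,\dots,y_n)=0,\ i=1,\dots,M\}$. Write $y=(y_1,\dots,y_n)$, let $I(Y)\subseteq\mathbb{C}[y]$ be the vanishing ideal of $Y$ and $\mathbb{C}[Y]=\mathbb{C}[y]/I(Y)$. The integer $r$ is given. Monomials are ordered by the graded lexicographic order $1<y_1<\cdots<y_n<y_1^2<y_1y_2<\cdots$, and $B_0=\{y^{\beta_1},\dots,y^{\beta_r}\}$ is the set of the first $r$ monomials whose images in $\mathbb{C}[Y]$ are linearly independent. For $v\in\mathbb{C}^n$, $B_0(v)\in\mathbb{C}^r$ is the column vector with $i$th entry $v^{\beta_i}$, and $$D=\{(v_1,\dots,v_r)\in(\mathbb{C}^n)^r:\ \det[\,B_0(v_1)\ \cdots\ B_0(v_r)\,]\ne0\}.$$ Put $B_1=B_0\cup y_1B_0\cup\cdots\cup y_nB_0$ and $\partial B_1=B_1\setminus B_0$; monomials are identified with their exponents. For a matrix $G=(c_{i,\alpha})_{i\in[r],\,\alpha\in\partial B_1}\in\mathbb{C}^{[r]\times\partial B_1}$ and $\alpha\in\partial B_1$ let $\varphi[G,\alpha]:=\sum_{i=1}^r c_{i,\alpha}y^{\beta_i}-y^\alpha$ and $\varphi[G]:=(\varphi[G,\alpha])_{\alpha\in\partial B_1}$; a zero of $\varphi[G]$ is a common zero in $\mathbb{C}^n$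 of all these polynomials. $\operatorname{S}^d(\mathbb{C}^{n+1})$ is the space of symmetric tensors of order $d$ on $\mathbb{C}^{n+1}$ (indices from $0$ to $n$); $u^{\otimes d}$ has entries $u_{i_1}\cdots u_{i_d}$. Symmetric tensors are labelled by $\alpha\in\mathbb{N}^n$ with $|\alpha|\le d$: $\mathcal{A}_\alpha:=\mathcal{A}_{j_1\dots j_d}$ if $x_0^{d-|\alpha|}x_1^{\alpha_1}\cdots x_n^{\alpha_n}=x_{j_1}\cdots x_{j_d}$. For $p=\sum_{|\alpha|\le d}p_\alpha y^\alpha$ put $\langle p,\mathcal{A}\rangle=\sum_\alpha p_\alpha\mathcal{A}_\alpha$. The polynomial $\varphi[G,\alpha]$ is a generating polynomial for $\mathcal{A}$ if $\langle y^\gamma\varphi[G,\alpha],\mathcal{A}\rangle=0$ for all $\gamma\in\mathbb{N}^n$ with $|\gamma|\le d-|\alpha|$, equivalently $\sum_{i=1}^r c_{i,\alpha}\mathcal{A}_{\beta_i+\gamma}=\mathcal{A}_{\alpha+\gamma}$ for all such $\gamma$. $G$ is a generating matrix for $\mathcal{A}$ if $\varphi[G,\alpha]$ is a generating polynomial for $\mathcal{A}$ for every $\alpha\in\partial B_1$; $\mathcal{G}(\mathcal{A})$ is the set of all generating matrices for $\mathcal{A}$. *)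

(* Defs.v *)
From HB Require Import structures.
From mathcomp Require Import all_boot all_order all_algebra.
From mathcomp Require Import perm finmap.
From mathcomp Require Import reals.
From mathcomp Require Import complex mpoly.

Set Implicit Arguments.
Unset Strict Implicit.
Unset Printing Implicit Defensive.

Import Order.TTheory GRing.Theory.
Local Open Scope fset_scope.
Local Open Scope ring_scope.

(* A monomial is identified with its exponent in 'X_{1..n}; the variable y_j   *)
(* is U_(j - 1) and the coordinate x_j is the one of index j : 'I_n.+1.        *)

Section Varieties.
Variables (F : fieldType) (n : nat).

(* The point (1, v_1, ..., v_n). *)
Definition lift_pt (v : 'rV[F]_n) : 'rV[F]_n.+1 := row_mx (1%:M : 'rV_1) v.

Definition cone_variety M (h : 'I_M -> {mpoly F[n.+1]}) (x : 'rV[F]_n.+1) :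
  Prop := forall i, (h i).@[x 0] = 0.

Definition affine_variety M (h : 'I_M -> {mpoly F[n.+1]}) (y : 'rV[F]_n) :
  Prop := cone_variety h (lift_pt y).

Definition vanishing_ideal (Y : 'rV[F]_n -> Prop) (p : {mpoly F[n]}) : Prop :=
  forall y, Y y -> p.@[y 0] = 0.

(* A linear combination of images vanishes in F[Y] = F[y] / I(Y) exactly when  *)
(* the same combination of monomials lies in I(Y).                             *)
Definition indep_in_coordinate_ring (Y : 'rV[F]_n -> Prop)
    (s : seq 'X_{1..n}) : Prop :=
  forall c : 'I_(size s) -> F,
    vanishing_ideal Y (\sum_(i < size s) c i *: 'X_[tnth (in_tuple s) i]) ->
    forall i, c i = 0.

(* The library order on 'X_{1..n} compares degrees and then exponents          *)
(* lexicographically, so that y_n < ... < y_1. Reversing it within each degree *)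
(* gives 1 < y_1 < ... < y_n < y_1^2 < y_1 y_2 < ...                           *)
Definition grlex_lt (a b : 'X_{1..n}) : bool :=
  (mdeg a < mdeg b)%N || (mdeg a == mdeg b) && (b < a)%O.

(* B0 lists, in increasing order, the first r monomials with linearly          *)
(* independent images: every monomial passed over before the last element of   *)
(* B0 is dependent on the elements of B0 that precede it.                      *)
Definition first_independent (Y : 'rV[F]_n -> Prop) r
    (B0 : r.-tuple 'X_{1..n}) : Prop :=
  [/\ sorted grlex_lt B0,
      indep_in_coordinate_ring Y B0
    & forall m b : 'X_{1..n}, m \notin B0 -> b \in B0 -> grlex_lt m b ->
        ~ indep_in_coordinate_ring Y (rcons [seq a <- B0 | grlex_lt a m] m)].

End Varieties.

Section Tensors.
Variables (F : fieldType) (n d : nat).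

Definition tensor := {ffun d.-tuple 'I_n.+1 -> F}.

Definition symmetric_tensor (A : tensor) : Prop :=
  forall (s : 'S_d) (j : d.-tuple 'I_n.+1),
    A [tuple tnth j (s k) | k < d] = A j.

Definition tensor_power (u : 'rV[F]_n.+1) : tensor :=
  [ffun j => \prod_(k < d) u 0 (tnth j k)].

Definition decomposes r (A : tensor) (l : 'I_r -> F)
    (v : 'I_r -> 'rV[F]_n) : Prop :=
  A = [ffun j => \sum_(k < r) l k * tensor_power (lift_pt (v k)) j].

(* x_0^{d - |a|} x_1^{a_1} ... x_n^{a_n} *)
Definition homog_exp (a : 'X_{1..n}) : 'X_{1..n.+1} :=
  (U_(ord0) *+ (d - mdeg a) + \sum_(i < n) U_(lift ord0 i) *+ a i)%MM.

(* A_a is the entry of A at any index (j_1, ..., j_d) such that                *)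
(* x_{j_1} ... x_{j_d} = x_0^{d - |a|} x^a; for symmetric A the choice of the  *)
(* index is immaterial. If d < |a| there is no such index and the value is 0.  *)
Definition label (A : tensor) (a : 'X_{1..n}) : F :=
  if [pick j : d.-tuple 'I_n.+1
        | (\sum_(k < d) U_(tnth j k))%MM == homog_exp a] is Some j
  then A j else 0.

(* Only monomials of degree at most d contribute. The paired polynomials       *)
(* y^g * phi G a with |g| + |a| <= d can have degree above d when some b in B0 *)
(* has |b| > |a|.                                                              *)
Definition pairing (p : {mpoly F[n]}) (A : tensor) : F :=
  \sum_(a : 'X_{1..n < d.+1}) p@_a * label A a.

End Tensors.

Section GeneratingMatrices.
Variables (F : fieldType) (n r : nat) (B0 : r.-tuple 'X_{1..n}).

Definition B0vec (v : 'rV[F]_n) : 'cV[F]_r := \col_i ('X_[tnth B0 i]).@[v 0].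

Definition in_D (v : 'I_r -> 'rV[F]_n) : Prop :=
  \det (\matrix_(i, k) B0vec (v k) i 0) != 0.

Definition B0set : {fset 'X_{1..n}} := [fset b in (B0 : seq 'X_{1..n})].

Definition B1set : {fset 'X_{1..n}} :=
  B0set `|` [fset b in [seq (U_(j) + a)%MM | j <- enum 'I_n, a <- B0]].

Definition dB1 : {fset 'X_{1..n}} := B1set `\` B0set.

(* F^{[r] x dB1}; the entry c_{i, a} of G is G (i, a). *)
Definition dB1_matrix := {ffun 'I_r * dB1 -> F}.

Definition phi (G : dB1_matrix) (a : dB1) : {mpoly F[n]} :=
  \sum_(i < r) G (i, a) *: 'X_[tnth B0 i] - 'X_[val a].

Definition zero_of_phi (G : dB1_matrix) (v : 'rV[F]_n) : Prop :=
  forall a : dB1, (phi G a).@[v 0] = 0.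

Definition generating_polynomial d (A : tensor F n d) (G : dB1_matrix)
    (a : dB1) : Prop :=
  forall g : 'X_{1..n}, (mdeg g + mdeg (val a) <= d)%N ->
    pairing ('X_[g] * phi G a) A = 0.

Definition generating_matrix d (A : tensor F n d) (G : dB1_matrix) : Prop :=
  forall a : dB1, generating_polynomial A G a.

End GeneratingMatrices.

(* Main.v *)
(* Let W be the span of the vectors (v_1^b, ..., v_r^b) with b in B0. At zeros
   of phi G the span W is stable under coordinatewise multiplication by each
   y_j, and it contains the image of 1, hence the image of every polynomial; for
   distinct points this forces W to be the whole space, i.e. (v_1, ..., v_r)
   lies in D. On D, each column of G is determined by the values of B0 at the
   v_k. Because the v_k lie on Y and B0 collects the first independent
   monomials, G (i, a) is nonzero only if b_i < a in the graded order. Hence the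
   relations y^g phi G a have degree |g| + |a| and are not truncated by the
   pairing, which gives existence in (ii). For (i), choose the weights so that
   the labels in B0 agree; the relations rewrite every other label in terms of
   strictly smaller monomials, so all labels agree. *)
Require Import Defs.
From HB Require Import structures.
From mathcomp Require Import all_boot all_order all_algebra.
From mathcomp Require Import finmap perm.
From mathcomp Require Import reals.
From mathcomp Require Import complex mpoly.

Set Implicit Arguments.
Unset Strict Implicit.
Unset Printing Implicit Defensive.

Import Order.TTheory GRing.Theory.
Local Open Scope ring_scope.

(** * Induction principles for monomials and the graded lexicographic order *)

Lemma multinom_ind n (P : 'X_{1..n} -> Prop) :
  P 0%MM -> (forall j m, P m -> P (U_(j) + m)%MM) -> forall m, P m.
Proof.
move=> P0 PS m; have [k] := ubnP (mdeg m); elim: k m => // k IHk m le_mk.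
have [->//|m_neq0] := eqVneq m 0%MM.
have [j mj_neq0] : exists j, m j != 0%N.
  apply/existsP; apply: contraNT m_neq0 => /existsPn m0.
  by apply/eqP/mnmP => j; rewrite mnm0E; apply/eqP/negbNE/m0.
have le_Um : (U_(j) <= m)%MM by rewrite lep1mP.
have mE : m = (U_(j) + (m - U_(j)))%MM by rewrite addmC submK.
rewrite mE; apply/PS/IHk.
by move: le_mk; rewrite {1}mE mdegD mdeg1.
Qed.

Section GradedLexOrder.
Variable n : nat.
Implicit Types a b c : 'X_{1..n}.

Lemma grlex_irr a : grlex_lt a a = false.
Proof. by rewrite /grlex_lt ltnn ltxx andbF. Qed.

Lemma grlex_trans : transitive (@grlex_lt n).
Proof.
move=> b a c; rewrite /grlex_lt.
case/orP => [ab|/andP[/eqP-> ab]].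
  by case/orP => [bc|/andP[/eqP<- _]]; rewrite ?ab ?(ltn_trans ab bc).
case/orP => [->//|/andP[/eqP<- bc]].
by rewrite eqxx (lt_trans bc ab) orbT.
Qed.

Lemma grlex_total a b : a != b -> grlex_lt a b || grlex_lt b a.
Proof.
rewrite /grlex_lt; case: ltngtP => //= _.
by case: ltgtP.
Qed.

Lemma grlex_mdeg a b : grlex_lt a b -> (mdeg a <= mdeg b)%N.
Proof. by case/orP => [/ltnW//|/andP[/eqP-> _]]. Qed.

Lemma grlex_add2l c a b : grlex_lt (c + a)%MM (c + b)%MM = grlex_lt a b.
Proof. by rewrite /grlex_lt !mdegD ltn_add2l eqn_add2l ltmc_add2r. Qed.

Lemma grlex_le0m a : grlex_lt a 0%MM = false.
Proof.
rewrite /grlex_lt mdeg0 /= mdeg_eq0; case: eqVneq => //= ->.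
by rewrite ltxx.
Qed.

(** Since the order is graded, everything below [a] has degree at most [mdeg a], so only finitely
    many monomials lie below it. The induction runs on their number. *)
Lemma grlex_ltwf (P : 'X_{1..n} -> Prop) :
  (forall a, (forall b, grlex_lt b a -> P b) -> P a) -> forall a, P a.
Proof.
move=> IH a.
pose below (c : 'X_{1..n}) d :=
  [set m : 'X_{1..n < d.+1} | grlex_lt (m : 'X_{1..n}) c].
suff below_ind k d c : (mdeg c <= d)%N -> (#|below c d| < k)%N -> P c.
  exact: (below_ind _ _ a (leqnn _) (ltnSn _)).
elim: k c => // k IHk c le_ad lt_k.
apply: IH => b lt_ba; have le_bd := leq_trans (grlex_mdeg lt_ba) le_ad.
apply: (IHk _ le_bd); rewrite ltnS in lt_k; apply: leq_trans lt_k; apply: proper_card.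
apply/properP; split.
  by apply/subsetP => m; rewrite !inE => /grlex_trans; apply.
by exists (@BMultinom _ d.+1 b le_bd); rewrite !inE //= grlex_irr.
Qed.

End GradedLexOrder.

(** * Labels of symmetric tensors and the pairing with polynomials *)

Section Labels.
Variables (F : fieldType) (n d : nat).
Implicit Types (a : 'X_{1..n}) (j : d.-tuple 'I_n.+1) (A : tensor F n d).

Lemma sum_mnm1_tuple j i :
  (\sum_(k < d) U_(tnth j k))%MM i = count_mem i j.
Proof.
rewrite mnm_sumE -sum1_count big_tuple [RHS]big_mkcond /=.
by apply: eq_bigr => k _; rewrite mnm1E; case: eqP.
Qed.

Lemma homog_exp0 a : homog_exp d a ord0 = (d - mdeg a)%N.
Proof.
rewrite mnmDE mulmnE mnm1E eqxx mul1n mnm_sumE big1 ?addn0 // => i _.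
by rewrite mulmnE mnm1E.
Qed.

Lemma homog_exp_lift a i : homog_exp d a (lift ord0 i) = a i.
Proof.
rewrite mnmDE mulmnE mnm1E mul0n add0n mnm_sumE (bigD1 i) //=.
rewrite mulmnE mnm1E eqxx mul1n big1 ?addn0 // => k ne_ki.
by rewrite mulmnE mnm1E (inj_eq lift_inj) (negbTE ne_ki).
Qed.

Lemma homog_expP a : (mdeg a <= d)%N ->
  exists j, (\sum_(k < d) U_(tnth j k))%MM = homog_exp d a.
Proof.
move=> le_ad; have mdeg_hom : mdeg (homog_exp d a) = d.
  rewrite mdegE big_ord_recl homog_exp0 -[RHS](subnK le_ad) mdegE.
  by congr addn; apply: eq_bigr => i _; rewrite homog_exp_lift.
(* [m2s] writes a monomial as a list of its variables with multiplicity, so degree [d] makes this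
   list a valid tensor index. *)
have /eqP sz := size_m2s (homog_exp d a); rewrite mdeg_hom in sz.
exists (Tuple sz); apply/mnmP => i; rewrite sum_mnm1_tuple /=.
by rewrite -[in RHS](s2mK (homog_exp d a)) mnmE.
Qed.

Lemma lift_pt0 (v : 'rV[F]_n) : lift_pt v 0 ord0 = 1.
Proof.
have -> : (ord0 : 'I_n.+1) = lshift n (0 : 'I_1) by exact: val_inj.
by apply: etrans (row_mxEl _ _ _ _) _; rewrite mxE.
Qed.

Lemma lift_ptS (v : 'rV[F]_n) i : lift_pt v 0 (lift ord0 i) = v 0 i.
Proof.
have -> : lift ord0 i = rshift 1 i :> 'I_n.+1 by exact: val_inj.
exact: row_mxEr.
Qed.

(** The coordinate x_0 of [lift_pt v] is 1, so the homogenizing power of x_0 contributes a factor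
    1. *)
Lemma tensor_power_lift (v : 'rV[F]_n) j a :
  (\sum_(k < d) U_(tnth j k))%MM = homog_exp d a ->
  tensor_power d (lift_pt v) j = 'X_[a].@[v 0].
Proof.
move=> jE; transitivity ('X_[homog_exp d a].@[lift_pt v 0]).
  rewrite ffunE -jE -mprodXE rmorph_prod /=.
  by apply: eq_bigr => k _; rewrite mevalXU.
rewrite !mevalX big_ord_recl lift_pt0 expr1n mul1r.
by apply: eq_bigr => i _; rewrite lift_ptS homog_exp_lift.
Qed.

Lemma label_decomposes r A (l : 'I_r -> F) v a :
  decomposes A l v -> (mdeg a <= d)%N ->
  label A a = \sum_(k < r) l k * 'X_[a].@[v k 0].
Proof.
move=> -> le_ad; rewrite /label; case: pickP => [j /eqP jE|no_j].
  rewrite ffunE; apply: eq_bigr => k _.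
  by rewrite (tensor_power_lift _ jE).
by have [j /eqP] := homog_expP le_ad; rewrite no_j.
Qed.

(** Two indices with the same product of variables are permutations of each other, so symmetry
    identifies the entry at [j] with the one selected by [label]. *)
Lemma symmetric_label A j : symmetric_tensor A ->
  exists2 a, (mdeg a <= d)%N &
    (\sum_(k < d) U_(tnth j k))%MM = homog_exp d a /\ A j = label A a.
Proof.
move=> A_sym; pose m := (\sum_(k < d) U_(tnth j k))%MM.
pose a : 'X_{1..n} := [multinom m (lift ord0 i) | i < n].
have mdeg_m : mdeg m = d.
  rewrite mdeg_sum (eq_bigr (fun=> 1%N)) => [|k _]; last exact: mdeg1.
  by rewrite sum1_card card_ord.
have mdegE_m : (m ord0 + mdeg a)%N = d.
  rewrite -[RHS]mdeg_m !mdegE big_ord_recl; congr addn.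
  by apply: eq_bigr => i _; rewrite mnmE.
have jE : m = homog_exp d a.
  apply/mnmP => i; case: (unliftP ord0 i) => [i'|] ->.
    by rewrite homog_exp_lift mnmE.
  by rewrite homog_exp0 -mdegE_m addnK.
exists a; first by rewrite -mdegE_m leq_addl.
split=> //; rewrite /label; case: pickP => [j' /eqP j'E|/(_ j)].
  have /tuple_permP[s sE] : perm_eq j' j.
    apply/allP => i _; apply/eqP.
    by rewrite -!sum_mnm1_tuple j'E -jE.
  by rewrite -(A_sym s j); congr (A _); apply: val_inj.
by rewrite -/m jE eqxx.
Qed.

Lemma decomposes_label r A (l : 'I_r -> F) (v : 'I_r -> 'rV[F]_n) : symmetric_tensor A ->
  (forall a, (mdeg a <= d)%N ->
    label A a = \sum_(k < r) l k * 'X_[a].@[v k 0]) ->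
  decomposes A l v.
Proof.
move=> A_sym A_label; apply/ffunP => j; rewrite ffunE.
have [a le_ad [jE ->]] := symmetric_label j A_sym; rewrite A_label //.
by apply: eq_bigr => k _; rewrite (tensor_power_lift _ jE).
Qed.

Lemma pairingX A a : (mdeg a <= d)%N -> pairing 'X_[a] A = label A a.
Proof.
move=> le_ad; rewrite /pairing (bigD1 (@BMultinom _ d.+1 a le_ad)) //=.
rewrite mcoeffX eqxx mul1r big1 ?addr0 // => m ne_ma.
rewrite mcoeffX; case: eqVneq => [am|_]; last by rewrite mul0r.
by case/eqP: ne_ma; apply: val_inj.
Qed.

Lemma pairingB A p q : pairing (p - q) A = pairing p A - pairing q A.
Proof.
by rewrite -sumrB; apply: eq_bigr => m _; rewrite mcoeffB mulrBl.
Qed.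

Lemma pairing_lincomb A (I : finType) (c : I -> F) (p : I -> {mpoly F[n]}) :
  pairing (\sum_i c i *: p i) A = \sum_i c i * pairing (p i) A.
Proof.
under [RHS]eq_bigr do rewrite mulr_sumr.
rewrite exchange_big /=; apply: eq_bigr => m _.
rewrite raddf_sum mulr_suml; apply: eq_bigr => i _.
by rewrite /= mcoeffZ mulrA.
Qed.

End Labels.

(** Without repetitions in [s], coefficients indexed by positions are the same as coefficients
    indexed by monomials; the latter survive filtering and [rcons]. *)
Lemma indep_in_coordinate_ringP (F : fieldType) n (Y : 'rV[F]_n -> Prop)
    (s : seq 'X_{1..n}) : uniq s ->
  (forall f : 'X_{1..n} -> F,
    vanishing_ideal Y (\sum_(m <- s) f m *: 'X_[m]) ->
    {in s, forall m, f m = 0}) ->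
  indep_in_coordinate_ring Y s.
Proof.
move=> s_uniq indep_s c c_van i.
pose f m := if insub (index m s) is Some k then c k else 0.
have fE k : f (tnth (in_tuple s) k) = c k.
  rewrite /f (tnth_nth 0%MM) index_uniq //= insubT //= => lt_k.
  by congr c; apply: val_inj.
rewrite -fE; apply: indep_s; last by rewrite mem_tnth.
rewrite big_tnth; congr (vanishing_ideal Y _): c_van.
by apply: eq_bigr => k _; rewrite fE.
Qed.

(** * Values of [B0] at the points, the zeros of [phi G], and border monomials *)

Section Zeros.
Variables (F : fieldType) (n r : nat) (B0 : r.-tuple 'X_{1..n}).
Variable v : 'I_r -> 'rV[F]_n.
Implicit Types (G : dB1_matrix F B0) (a : dB1 B0) (m g : 'X_{1..n}).

(** Rows are indexed by [B0] and columns by points: row vectors acting on the left are coefficients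
    of polynomials, column vectors on the right are weights of the points. *)
Let B0mx : 'M[F]_r := \matrix_(i, k) B0vec B0 (v k) i 0.

Lemma in_D_unitmx : in_D B0 v <-> B0mx \in unitmx.
Proof. by rewrite /in_D unitmxE unitfE. Qed.

Lemma B0mxE i k : B0mx i k = 'X_[tnth B0 i].@[v k 0].
Proof. by rewrite !mxE. Qed.

Lemma in_D_lincomb0 (c : 'I_r -> F) : in_D B0 v ->
  (forall k, \sum_i c i * 'X_[tnth B0 i].@[v k 0] = 0) -> forall i, c i = 0.
Proof.
move=> /in_D_unitmx B0_unit c0 i.
have cB0 : (\row_i c i) *m B0mx = 0.
  apply/rowP => k; rewrite !mxE -[RHS](c0 k).
  by apply: eq_bigr => i' _; rewrite B0mxE mxE.
have := congr1 (mulmx^~ (invmx B0mx)) cB0.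
by rewrite /= mulmxK // mul0mx => /rowP/(_ i); rewrite !mxE.
Qed.

Lemma in_D_interpolation (w : 'I_r -> F) : in_D B0 v ->
  exists c : 'I_r -> F,
    forall k, \sum_i c i * 'X_[tnth B0 i].@[v k 0] = w k.
Proof.
move=> /in_D_unitmx B0_unit; pose c := (\row_k w k) *m invmx B0mx.
exists (c 0) => k; transitivity ((c *m B0mx) 0 k); last by rewrite mulmxKV // mxE.
by rewrite mxE; apply: eq_bigr => i _; rewrite B0mxE.
Qed.

Lemma in_D_weights (w : 'I_r -> F) : in_D B0 v ->
  exists l : 'I_r -> F,
    forall i, \sum_k l k * 'X_[tnth B0 i].@[v k 0] = w i.
Proof.
move=> /in_D_unitmx B0_unit; pose l := invmx B0mx *m (\col_i w i).
exists (l^~ 0) => i; transitivity ((B0mx *m l) i 0); last by rewrite mulKVmx // mxE.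
by rewrite mxE; apply: eq_bigr => k _; rewrite B0mxE mulrC.
Qed.

Lemma phi_eval G a (u : 'rV[F]_n) :
  (phi G a).@[u 0]
    = \sum_i G (i, a) * 'X_[tnth B0 i].@[u 0] - 'X_[val a].@[u 0].
Proof.
rewrite mevalB raddf_sum /=; congr (_ - _).
by apply: eq_bigr => i _; rewrite mevalZ.
Qed.

Lemma zero_of_phiP G (u : 'rV[F]_n) :
  zero_of_phi G u <->
  forall a, \sum_i G (i, a) * 'X_[tnth B0 i].@[u 0] = 'X_[val a].@[u 0].
Proof.
split=> zG a; last by rewrite phi_eval zG subrr.
by apply/eqP; rewrite -subr_eq0 -phi_eval zG.
Qed.

Lemma notin_B0_dB1 a : val a \notin B0.
Proof. by have := valP a; rewrite !inE => /andP[]. Qed.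

Lemma border_cases j m : m \in B0 ->
  (U_(j) + m)%MM \in B0 \/ exists a, (U_(j) + m)%MM = val a.
Proof.
move=> B0m; have [|notB0] := boolP ((U_(j) + m)%MM \in B0); first by left.
right; have dB1m : (U_(j) + m)%MM \in dB1 B0.
  rewrite !inE /= notB0 /=; apply/orP; right.
  by apply/allpairsP; exists (j, m); rewrite mem_enum.
by exists [` dB1m]%fset.
Qed.

(** Multiply up from 1 one variable at a time. The first step out of [B0] lands on a border
    monomial, and all later factors are collected in [g]. *)
Lemma multiple_of_border m : 0%MM \in B0 ->
  m \in B0 \/ exists g a, m = (g + val a)%MM.
Proof.
move=> B00; elim/multinom_ind: m => [|j m [B0m|[g [a ->]]]]; first by left.
  case: (border_cases j B0m) => [|[a ->]]; [by left | right].
  by exists 0%MM, a; rewrite add0m.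
by right; exists (U_(j) + g)%MM, a; rewrite addmA.
Qed.

Lemma zeros_in_D G : 0%MM \in B0 -> injective v ->
  (forall k, zero_of_phi G (v k)) -> in_D B0 v.
Proof.
move=> B00 v_inj Gv; apply/in_D_unitmx.
pose ev (p : {mpoly F[n]}) : 'rV[F]_r := \row_k p.@[v k 0].
have ev_B0 m : m \in B0 -> (ev 'X_[m] <= B0mx)%MS.
  case/tnthP => i ->; rewrite (_ : ev _ = row i B0mx) ?row_sub //.
  by apply/rowP => k; rewrite !mxE.
have ev_dB1 a : (ev 'X_[val a] <= B0mx)%MS.
  have -> : ev 'X_[val a] = (\row_i G (i, a)) *m B0mx.
    apply/rowP => k; rewrite !mxE -(proj1 (zero_of_phiP _ _) (Gv k)).
    by apply: eq_bigr => i _; rewrite B0mxE mxE.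
  exact: submxMl.
have ev_mulX j p : ev ('X_j * p) = ev p *m diag_mx (ev 'X_j).
  apply/rowP => k; rewrite mxE mevalM mul_mx_diag !mxE.
  by rewrite mulrC.
have B0mx_stable j : (B0mx *m diag_mx (ev 'X_j) <= B0mx)%MS.
  apply/row_subP => i; rewrite row_mul.
  have -> : row i B0mx = ev 'X_[tnth B0 i] by apply/rowP => k; rewrite !mxE.
  rewrite -ev_mulX -mpolyXD.
  by case: (border_cases j (mem_tnth i B0)) => [/ev_B0//|[a ->]].
have ev_mon m : (ev 'X_[m] <= B0mx)%MS.
  elim/multinom_ind: m => [|j m IH]; first exact: ev_B0.
  by rewrite mpolyXD ev_mulX (submx_trans _ (B0mx_stable j)) ?submxMr.
have ev_sub p : (ev p <= B0mx)%MS.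
  have -> : ev p = \sum_(m <- msupp p) p@_m *: ev 'X_[m].
    apply/rowP => k; rewrite mxE [p in LHS]mpolyE raddf_sum summxE.
    by apply: eq_bigr => m _; rewrite /= mevalZ !mxE.
  by apply: summx_sub => m _; apply/scalemx_sub/ev_mon.
(* The row space is everything once it contains each standard basis vector, obtained below as the
   values of a Lagrange-type polynomial. *)
rewrite -row_full_unit -sub1mx; apply/row_subP => k.
(* The condition [k' != k] sits under the existential, with 0 as a dummy at [k], so that one choice
   function [q] covers all indices. *)
have sep k' : exists q : {mpoly F[n]},
    k' != k -> q.@[v k' 0] = 0 /\ q.@[v k 0] != 0.
  have [->|ne_k'k] := eqVneq k' k; first by exists 0.
  have [j ne_j] : exists j, v k 0 j != v k' 0 j.
    apply/existsP; apply: contraNT ne_k'k => /existsPn eq_v.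
    apply/eqP/v_inj/rowP => j; apply/esym/eqP/negbNE/eq_v.
  exists ('X_j - (v k' 0 j)%:MP) => _.
  by rewrite !mevalB !mevalXU !mevalC subrr subr_eq0.
have [q q_sep] := fin_all_exists sep.
pose p := \prod_(k' | k' != k) q k'.
have p_vk : p.@[v k 0] != 0.
  by rewrite rmorph_prod; apply/prodf_neq0 => k' /q_sep[].
have -> : row k 1%:M = (p.@[v k 0])^-1 *: ev p.
  apply/rowP => k'; rewrite !mxE; have [<-|ne_kk'] := eqVneq k k'.
    by rewrite mulVf.
  rewrite [X in _ * X]rmorph_prod (bigD1 k') 1?eq_sym //=.
  by rewrite (q_sep k' _).1 1?eq_sym // mul0r mulr0.
exact/scalemx_sub/ev_sub.
Qed.

(** * Consequences of the minimality of [B0] when the points lie on [Y] *)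

Section Support.
Variable Y : 'rV[F]_n -> Prop.
Hypothesis B0_first : first_independent Y B0.
Hypothesis vY : forall k, Y (v k).

(** The monomial 1 is the smallest. If it were passed over, minimality would make it dependent on
    its own in the coordinate ring, yet it takes the value 1 at a point of [Y]. *)
Lemma zero_in_B0 : (0 < r)%N -> 0%MM \in B0.
Proof.
move=> r_gt0; pose k := Ordinal r_gt0; case: B0_first => _ _ B0_min.
have [<-|/grlex_total] := eqVneq (tnth B0 k) 0%MM; first exact: mem_tnth.
rewrite grlex_le0m => lt_0k; apply: contraT => notB00.
case: (B0_min _ _ notB00 (mem_tnth k B0) lt_0k).
rewrite (eq_filter (a2 := pred0)) ?filter_pred0 => [|m]; last exact: grlex_le0m.
apply: indep_in_coordinate_ringP => // f /(_ _ (vY k)).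
rewrite big_seq1 mevalZ mevalX big1 ?mulr1 => [f0 m|i _]; last first.
  by rewrite mnm0E expr0.
by rewrite inE => /eqP->.
Qed.

(* The columns of G at a border monomial a below max B0 are pinned down by the
   relation expressing a through the earlier elements of B0 in F[Y]. *)
Lemma phi_support G i a : in_D B0 v -> (forall k, zero_of_phi G (v k)) ->
  G (i, a) != 0 -> grlex_lt (tnth B0 i) (val a).
Proof.
move=> vD Gv Gia; apply: contraT => not_lt.
have ne_ia : tnth B0 i != val a.
  by apply: contraNneq (notin_B0_dB1 a) => <-; apply: mem_tnth.
have := grlex_total ne_ia; rewrite (negbTE not_lt) => lt_ai.
case: B0_first => B0_sorted _ B0_min.
case: (B0_min _ _ (notin_B0_dB1 a) (mem_tnth i B0) lt_ai).
have B0_uniq : uniq B0 := sorted_uniq (@grlex_trans n) (@grlex_irr n) B0_sorted.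
apply: indep_in_coordinate_ringP => [|f f_van].
  by rewrite rcons_uniq mem_filter grlex_irr filter_uniq.
have f_eval k :
    \sum_i (if grlex_lt (tnth B0 i) (val a) then f (tnth B0 i) else 0)
        * 'X_[tnth B0 i].@[v k 0]
      + f (val a) * 'X_[val a].@[v k 0] = 0.
  rewrite -[RHS](f_van _ (vY k)) raddf_sum /= big_rcons /= mevalZ big_filter.
  rewrite big_tuple [in RHS]big_mkcond /=; congr (_ + _).
  by apply: eq_bigr => i' _; case: ifP; rewrite ?mul0r ?mevalZ.
(* At each zero of [phi G] the border monomial can be replaced by its combination of [B0], which
   leaves a relation among [B0] alone. *)
have coef0 i' :
    (if grlex_lt (tnth B0 i') (val a) then f (tnth B0 i') else 0)
      + f (val a) * G (i', a) = 0.
  move: i'; apply: in_D_lincomb0 => // k; rewrite -[RHS](f_eval k).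
  rewrite -(proj1 (zero_of_phiP _ _) (Gv k)) mulr_sumr -big_split /=.
  by apply: eq_bigr => i' _; rewrite mulrDl mulrA.
(* At index [i] the relation has only its padding coefficient 0, so [f (val a) * G (i, a)] vanishes
   although [G (i, a)] does not. *)
have fa0 : f (val a) = 0.
  have := coef0 i; rewrite (negbTE not_lt) add0r => /eqP.
  by rewrite mulf_eq0 (negbTE Gia) orbF => /eqP.
move=> m; rewrite mem_rcons inE mem_filter => /orP[/eqP->//|/andP[lt_ma]].
case/tnthP => i' mE; have := coef0 i'.
by rewrite -mE lt_ma fa0 mul0r addr0.
Qed.

End Support.

(** * Generating relations as linear recurrences between labels *)

Section Pairing.
Variables (d : nat) (A : tensor F n d).

Lemma pairing_phi G g a : (mdeg g + mdeg (val a) <= d)%N ->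
  (forall i, G (i, a) != 0 -> grlex_lt (tnth B0 i) (val a)) ->
  pairing ('X_[g] * phi G a) A
    = \sum_i G (i, a) * label A (g + tnth B0 i)%MM - label A (g + val a)%MM.
Proof.
move=> le_d G_supp; rewrite /phi mulrBr mulr_sumr -mpolyXD.
under eq_bigr do rewrite -scalerAr -mpolyXD.
rewrite pairingB pairing_lincomb pairingX ?mdegD //; congr (_ - _).
apply: eq_bigr => i _; have [->|/G_supp/grlex_mdeg le_ia] := eqVneq (G (i, a)) 0.
  by rewrite !mul0r.
by rewrite pairingX // mdegD (leq_trans _ le_d) // leq_add2l.
Qed.

Lemma decomposes_generating G (l : 'I_r -> F) : decomposes A l v ->
  (forall k, zero_of_phi G (v k)) ->
  (forall i a, G (i, a) != 0 -> grlex_lt (tnth B0 i) (val a)) ->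
  generating_matrix A G.
Proof.
move=> A_dec Gv G_supp a g le_d; rewrite (pairing_phi le_d (G_supp^~ a)).
apply/eqP; rewrite subr_eq0; apply/eqP.
transitivity (\sum_k l k * ('X_[g] * 'X_[val a]).@[v k 0]); last first.
  by rewrite (label_decomposes A_dec) ?mdegD // mpolyXD.
transitivity (\sum_i \sum_k l k *
    ('X_[g].@[v k 0] * (G (i, a) * 'X_[tnth B0 i].@[v k 0]))).
  apply: eq_bigr => i _.
  have [->|/G_supp/grlex_mdeg le_ia] := eqVneq (G (i, a)) 0.
    by rewrite mul0r big1 // => k _; rewrite mul0r !mulr0.
  rewrite (label_decomposes A_dec); last first.
    by rewrite mdegD (leq_trans _ le_d) // leq_add2l.
  rewrite mulr_sumr; apply: eq_bigr => k _.
  by rewrite mpolyXD mevalM mulrCA; congr (_ * _); rewrite mulrCA.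
rewrite exchange_big; apply: eq_bigr => k _ /=.
by rewrite -!mulr_sumr (proj1 (zero_of_phiP _ _) (Gv k)) mevalM.
Qed.

(** Outside [B0], write [m] as [g + val a]; the order is compatible with multiplication, so the
    recurrence reaches only the smaller monomials [g + b] with [b] in [B0], where the induction
    hypothesis applies. *)
Lemma generating_label G (l : 'I_r -> F) : 0%MM \in B0 ->
  generating_matrix A G ->
  (forall k, zero_of_phi G (v k)) ->
  (forall i a, G (i, a) != 0 -> grlex_lt (tnth B0 i) (val a)) ->
  (forall i,
    \sum_k l k * 'X_[tnth B0 i].@[v k 0] = label A (tnth B0 i)) ->
  forall m, (mdeg m <= d)%N ->
    label A m = \sum_k l k * 'X_[m].@[v k 0].
Proof.
move=> B00 A_gen Gv G_supp A_B0; elim/grlex_ltwf => m IHm le_md.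
case: (multiple_of_border m B00) => [/tnthP[i ->]//|[g [a mE]]].
have le_d : (mdeg g + mdeg (val a) <= d)%N by rewrite -mdegD -mE.
have := A_gen a g le_d; rewrite (pairing_phi le_d (G_supp^~ a)).
move/eqP; rewrite subr_eq0 mE => /eqP <-.
transitivity (\sum_i \sum_k l k *
    ('X_[g].@[v k 0] * (G (i, a) * 'X_[tnth B0 i].@[v k 0]))).
  apply: eq_bigr => i _.
  have [->|/G_supp lt_ia] := eqVneq (G (i, a)) 0.
    by rewrite mul0r big1 // => k _; rewrite mul0r !mulr0.
  rewrite IHm ?mE ?grlex_add2l //; last first.
    by rewrite mdegD (leq_trans _ le_d) // leq_add2l grlex_mdeg.
  rewrite mulr_sumr; apply: eq_bigr => k _.
  by rewrite mpolyXD mevalM mulrCA; congr (_ * _); rewrite mulrCA.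
rewrite exchange_big; apply: eq_bigr => k _ /=.
by rewrite -!mulr_sumr (proj1 (zero_of_phiP _ _) (Gv k)) mpolyXD mevalM.
Qed.

End Pairing.

End Zeros.

(** * From zeros to a decomposition, and from a decomposition to its unique generating matrix *)

Theorem theorem5p1 (R : realType) (n M r d : nat)
    (h : 'I_M -> {mpoly R[i][n.+1]})
    (h_homog : forall i, h i \is homog mdeg)
    (r_gt0 : (0 < r)%N)
    (B0 : r.-tuple 'X_{1..n})
    (B0_first : first_independent (affine_variety h) B0)
    (A : tensor R[i] n d) (A_sym : symmetric_tensor A) :
  (forall (G : dB1_matrix R[i] B0) (v : 'I_r -> 'rV[R[i]]_n),
      generating_matrix A G ->
      (forall k, affine_variety h (v k)) ->
      injective v ->
      (forall k, zero_of_phi G (v k)) ->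
      exists l : 'I_r -> R[i], decomposes A l v)
  /\
  (forall (v : 'I_r -> 'rV[R[i]]_n) (l : 'I_r -> R[i]),
      (forall k, affine_variety h (v k)) ->
      decomposes A l v ->
      in_D B0 v ->
      exists! G : dB1_matrix R[i] B0,
        generating_matrix A G /\ forall k, zero_of_phi G (v k)).
Proof.
split=> [G v A_gen vY v_inj Gv|v l vY A_dec vD].
  have B00 := zero_in_B0 B0_first vY r_gt0.
  have vD := zeros_in_D B00 v_inj Gv.
  (* The weights match all of [B0]; an element of degree above [d] enters with the default label
     0. *)
  have [l lB0] := in_D_weights (fun i => label A (tnth B0 i)) vD.
  exists l; apply: decomposes_label => // m.
  apply: (generating_label B00 A_gen Gv) => // i a.
  exact: (phi_support B0_first vY).
(* Column [a] of [G] interpolates the border monomial at the points by a combination of [B0]. *)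
have [c cE] := fin_all_exists (fun a : dB1 B0 =>
  in_D_interpolation (fun k => 'X_[val a].@[v k 0]) vD).
pose G : dB1_matrix R[i] B0 := [ffun p => c p.2 p.1].
have Gv k : zero_of_phi G (v k).
  apply/zero_of_phiP => a; rewrite -cE.
  by apply: eq_bigr => i _; rewrite ffunE.
exists G; split=> [|G' [_ G'v]].
  split=> //; apply: (decomposes_generating A_dec Gv) => i a.
  exact: (phi_support B0_first vY).
(* The difference of two such columns is a combination of [B0] vanishing at every point, hence zero
   on [D]. *)
apply/ffunP => -[i a]; apply/eqP; rewrite -subr_eq0; apply/eqP.
move: i; apply: (in_D_lincomb0 vD) => k.
under eq_bigr do rewrite mulrBl.
rewrite sumrB (proj1 (zero_of_phiP _ _) (Gv k)).
by rewrite (proj1 (zero_of_phiP _ _) (G'v k)) subrr.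
Qed.
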